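(* Let $\mathfrak{g}$ be a Lie algebra over a field $\mathbb{F}$, and let $M$ be a left $\mathfrak{g}$-module. Then the left hemi-semidirect product $\mathfrak{g}\ltimes_\ell M$ is Lie-simple if, and only if, $\mathfrak{g}$ is simple and $\mathfrak{g}M=M$.
   Context: The field $\mathbb{F}$ is arbitrary, and $\mathfrak{g}$ and $M$ may have arbitrary dimension. Ideals are two-sided. A left Leibniz algebra is an $\mathbb{F}$-vector space $\mathfrak{L}$ with a bilinear multiplication satisfying $x(yz)=(xy)z+y(xz)$ for all $x,y,z\in\mathfrak{L}$. Its Leibniz kernel is the ideal $\mathrm{Leib}(\mathfrak{L}):=\langle x^2\mid x\in\mathfrak{L}\rangle_{\mathbb{F}}$ (the linear span of all squares), and $\mathfrak{L}_{\mathrm{Lie}}:=\mathfrak{L}/\mathrm{Leib}(\mathfrak{L})$ is a Lie algebra, called the canonical Lie algebra of $\mathfrak{L}$. A Leibniz algebra $\mathfrak{L}$ is called Lie-simple if $\mathfrak{L}_{\mathrm{Lie}}$ is a simple Lie algebra. A Lie algebra is simple if it is non-abelian and its only ideals are $0$ and itself. For a Lie algebra $\mathfrak{g}$ and a left $\mathfrak{g}$-module $M$ (i.e. $[x,y]\cdot m=x\cdot(y\cdot m)-y\cdot(x\cdot m)$), the left hemi-semidirect product $\mathfrak{g}\ltimes_\ell M$ is the vector space $\mathfrak{g}\times M$ with multiplication $(g,m)(g',m'):=([g,g'],g\cdot m')$; it is a left Leibniz algebra. Moreover, $\mathfrak{g}M:=\langle g\cdot m\mid g\in\mathfrak{g},m\in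 M\rangle_{\mathbb{F}}$ (linear span). *)

(* Defs.v *)
From HB Require Import structures.
From mathcomp Require Import all_boot all_order all_algebra.
From mathcomp Require Import generic_quotient ring_quotient.
From mathcomp Require Import boolp classical_sets.

Set Implicit Arguments.
Unset Strict Implicit.
Unset Printing Implicit Defensive.

Import GRing.Theory.

Local Open Scope ring_scope.
Local Open Scope classical_set_scope.

Reserved Notation "x \** y" (at level 40, left associativity).
Reserved Notation "x \dot m" (at level 40, left associativity).
Reserved Notation "g \ltimes M" (at level 40, left associativity).

(* Not necessarily associative algebras, of arbitrary dimension. *)
HB.mixin Record Lmodule_hasBilinearMul (F : fieldType) (A : Type)
    of GRing.Lmodule F A := {
  bmul : A -> A -> A;
  bmul_linearl : forall y : A, linear (bmul^~ y);
  bmul_linearr : forall x : A, linear (bmul x)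
}.

#[short(type="bilinAlgType")]
HB.structure Definition BilinAlg (F : fieldType) :=
  {A of GRing.Lmodule F A & Lmodule_hasBilinearMul F A}.

Notation "x \** y" := (bmul x y) : ring_scope.

HB.mixin Record BilinAlg_isLeftLeibniz (F : fieldType) (L : Type)
    of BilinAlg F L := {
  left_leibniz : forall x y z : L,
    x \** (y \** z) = (x \** y) \** z + y \** (x \** z)
}.

#[short(type="leftLeibnizType")]
HB.structure Definition LeftLeibniz (F : fieldType) :=
  {L of BilinAlg F L & BilinAlg_isLeftLeibniz F L}.

HB.mixin Record BilinAlg_isLie (F : fieldType) (g : Type)
    of BilinAlg F g := {
  lie_alt : forall x : g, x \** x = 0;
  lie_jacobi : forall x y z : g,
    x \** (y \** z) + y \** (z \** x) + z \** (x \** y) = 0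
}.

#[short(type="lieAlgType")]
HB.structure Definition LieAlg (F : fieldType) :=
  {g of BilinAlg F g & BilinAlg_isLie F g}.

HB.mixin Record Lmodule_isLeftLieModule (F : fieldType) (g : lieAlgType F)
    (M : Type) of GRing.Lmodule F M := {
  lact : g -> M -> M;
  lact_linearl : forall m : M, linear (lact^~ m);
  lact_linearr : forall x : g, linear (lact x);
  lact_lie : forall (x y : g) (m : M),
    lact (x \** y) m = lact x (lact y m) - lact y (lact x m)
}.

#[short(type="leftLieModType")]
HB.structure Definition LeftLieModule (F : fieldType) (g : lieAlgType F) :=
  {M of GRing.Lmodule F M & Lmodule_isLeftLieModule F g M}.

Notation "x \dot m" := (lact x m) : ring_scope.

Section BilinearTheory.
Variables (F : fieldType) (A : bilinAlgType F).
Implicit Types x y z : A.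

HB.instance Definition _ x :=
  GRing.isLinear.Build F A A *:%R (bmul x) (bmul_linearr x).

Lemma bmulDr x y z : x \** (y + z) = x \** y + x \** z.
Proof. exact: linearD. Qed.

Lemma bmulBr x y z : x \** (y - z) = x \** y - x \** z.
Proof. exact: linearB. Qed.

Lemma bmulZr x (a : F) y : x \** (a *: y) = a *: (x \** y).
Proof. exact: linearZ. Qed.

Lemma bmul0r x : x \** 0 = 0.
Proof. exact: linear0. Qed.

Lemma bmul_sumr x n (f : 'I_n -> A) :
  x \** (\sum_(i < n) f i) = \sum_(i < n) x \** f i.
Proof. exact: linear_sum. Qed.

Lemma bmul0l x : 0 \** x = 0.
Proof.
have := bmul_linearl x 1 0 0; rewrite /= scaler0 addr0 scale1r => /eqP.
by rewrite -subr_eq subrr => /eqP.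
Qed.

Lemma bmulDl x y z : (x + y) \** z = x \** z + y \** z.
Proof. by have := bmul_linearl z 1 x y; rewrite /= !scale1r. Qed.

Lemma bmulZl (a : F) x z : (a *: x) \** z = a *: (x \** z).
Proof. by have := bmul_linearl z a x 0; rewrite /= bmul0l !addr0. Qed.

Lemma bmulBl x y z : (x - y) \** z = x \** z - y \** z.
Proof. by rewrite -scaleN1r bmulDl bmulZl scaleN1r. Qed.

Lemma bmul_suml n (f : 'I_n -> A) x :
  (\sum_(i < n) f i) \** x = \sum_(i < n) f i \** x.
Proof.
by apply: (big_morph (bmul^~ x)) => [y z|]; rewrite ?bmulDl ?bmul0l.
Qed.

End BilinearTheory.

Definition lin_span (F : fieldType) (V : lmodType F) (S : set V) : set V :=
  [set v | exists (n : nat) (a : 'I_n -> F) (s : 'I_n -> V),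
    (forall i, S (s i)) /\ v = \sum_(i < n) a i *: s i].

Section Span.
Variables (F : fieldType) (V : lmodType F) (S : set V).

Lemma lin_span0 : lin_span S 0.
Proof.
by exists 0, (fun=> 0), (fun=> 0); split; [case|rewrite big_ord0].
Qed.

Lemma lin_spanS v : S v -> lin_span S v.
Proof.
by exists 1, (fun=> 1), (fun=> v); split=> //; rewrite big_ord1 scale1r.
Qed.

Lemma lin_spanZ a v : lin_span S v -> lin_span S (a *: v).
Proof.
move=> [n [c [s [Ss ->]]]]; exists n, (fun i => a * c i), s; split=> //.
by rewrite scaler_sumr; apply: eq_bigr => i _; rewrite scalerA.
Qed.

Lemma lin_spanD u v : lin_span S u -> lin_span S v -> lin_span S (u + v).
Proof.
move=> [n [c [s [Ss ->]]]] [p [d [t [St ->]]]].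
pose glue T (f : 'I_n -> T) (h : 'I_p -> T) (i : 'I_(n + p)) :=
  match fintype.split i with inl j => f j | inr k => h k end.
have glueL T f h j : @glue T f h (lshift p j) = f j.
  by rewrite /glue -[lshift p j]/(unsplit (inl j)) unsplitK.
have glueR T f h j : @glue T f h (rshift n j) = h j.
  by rewrite /glue -[rshift n j]/(unsplit (inr j)) unsplitK.
exists (n + p)%N, (glue _ c d), (glue _ s t); split.
  by move=> i; rewrite /glue; case: fintype.split.
by rewrite big_split_ord /=; congr (_ + _); apply: eq_bigr => i _;
  rewrite ?glueL ?glueR.
Qed.

Lemma lin_span_sum n (f : 'I_n -> V) :
  (forall i, lin_span S (f i)) -> lin_span S (\sum_(i < n) f i).
Proof.
by move=> Sf; apply: big_ind => //; [exact: lin_span0|exact: lin_spanD].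
Qed.

End Span.

Record ideal (F : fieldType) (A : bilinAlgType F) (I : set A) : Prop := Ideal {
  ideal0 : I 0;
  idealD : forall x y, I x -> I y -> I (x + y);
  idealZ : forall (a : F) x, I x -> I (a *: x);
  idealMl : forall x y, I y -> I (x \** y);
  idealMr : forall x y, I x -> I (x \** y)
}.

Definition simple_lie (F : fieldType) (g : lieAlgType F) : Prop :=
  (exists x y : g, x \** y <> 0) /\
  (forall I : set g, ideal I -> I = [set 0] \/ I = [set: g]).

(* The quotient of an algebra by an ideal. Quotient.quot takes a boolean       *)
(* membership predicate, obtained here from the set I by classical             *)
(* decidability.                                                               *)
Section QuotientAlgebra.
Variables (F : fieldType) (A : bilinAlgType F) (I : set A) (idI : ideal I).

Definition ideal_pred & ideal I : {pred A} := fun x => `[< I x >].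

Let P := ideal_pred idI.

Lemma ideal_predP x : reflect (I x) (x \in P).
Proof. exact: asboolP. Qed.

Lemma ideal_pred_zmod_closed : zmod_closed P.
Proof.
split; first by apply/ideal_predP; exact: ideal0.
move=> x y /ideal_predP Ix /ideal_predP Iy; apply/ideal_predP.
by rewrite -scaleN1r; apply: idealD => //; apply: idealZ.
Qed.

HB.instance Definition _ :=
  GRing.isZmodClosed.Build A (ideal_pred idI) ideal_pred_zmod_closed.

Definition quot_alg : Type := (Quotient.quot (ideal_pred idI)).

HB.instance Definition _ := GRing.Zmodule.on quot_alg.

Definition quot_pi (x : A) : quot_alg := (\pi_(Quotient.quot (ideal_pred idI)) x)%qT.

Definition quot_repr (x : quot_alg) : A :=
  repr (x : (Quotient.quot (ideal_pred idI))).

Lemma quot_reprK : cancel quot_repr quot_pi.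
Proof. exact: reprK. Qed.

Lemma quot_piP x y : quot_pi x = quot_pi y <-> I (x - y).
Proof.
split=> [/eqP|Ixy].
  by rewrite /quot_pi -Quotient.idealrBE => /ideal_predP.
by apply/eqP; rewrite /quot_pi -Quotient.idealrBE; apply/ideal_predP.
Qed.

Lemma quot_piD x y : quot_pi (x + y) = quot_pi x + quot_pi y.
Proof. exact: (raddfD (\pi_(Quotient.quot (ideal_pred idI)))%qT). Qed.

Lemma quot_pi0 : quot_pi 0 = 0.
Proof. exact: (raddf0 (\pi_(Quotient.quot (ideal_pred idI)))%qT). Qed.

Definition quot_scale (a : F) (x : quot_alg) : quot_alg :=
  quot_pi (a *: quot_repr x).

Definition quot_mul (x y : quot_alg) : quot_alg :=
  quot_pi (quot_repr x \** quot_repr y).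

Lemma quot_repr_pi x : I (quot_repr (quot_pi x) - x).
Proof. by apply/quot_piP; rewrite quot_reprK. Qed.

Lemma quot_piZ_subproof a x : quot_scale a (quot_pi x) = quot_pi (a *: x).
Proof.
apply/quot_piP; rewrite -scalerBr.
by apply: idealZ => //; exact: quot_repr_pi.
Qed.

Lemma quot_piM_subproof x y :
  quot_mul (quot_pi x) (quot_pi y) = quot_pi (x \** y).
Proof.
apply/quot_piP; set x' := quot_repr _; set y' := quot_repr _.
have -> : x' \** y' - x \** y = (x' - x) \** y' + x \** (y' - y).
  by rewrite bmulBl bmulBr addrA subrK.
apply: idealD => //; first by apply: idealMr => //; exact: quot_repr_pi.
by apply: idealMl => //; exact: quot_repr_pi.
Qed.

Lemma quot_scaleA a b x : quot_scale a (quot_scale b x) = quot_scale (a * b) x.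
Proof. by rewrite -[x]quot_reprK !quot_piZ_subproof scalerA. Qed.

Lemma quot_scale1 : left_id 1 quot_scale.
Proof. by move=> x; rewrite -[x]quot_reprK quot_piZ_subproof scale1r. Qed.

Lemma quot_scaleDr : right_distributive quot_scale +%R.
Proof.
move=> a x y; rewrite -[x]quot_reprK -[y]quot_reprK -quot_piD.
by rewrite !quot_piZ_subproof -quot_piD scalerDr.
Qed.

Lemma quot_scaleDl x : {morph quot_scale^~ x : a b / a + b}.
Proof.
move=> a b; rewrite -[x]quot_reprK !quot_piZ_subproof -quot_piD.
by rewrite scalerDl.
Qed.

HB.instance Definition _ := GRing.Zmodule_isLmodule.Build F quot_alg
  quot_scaleA quot_scale1 quot_scaleDr quot_scaleDl.

Lemma quot_piZ a x : quot_pi (a *: x) = a *: quot_pi x.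
Proof. by rewrite -quot_piZ_subproof. Qed.

Lemma quot_mul_linearl (y : quot_alg) : linear (quot_mul^~ y).
Proof.
move=> a x z; rewrite -[x]quot_reprK -[y]quot_reprK -[z]quot_reprK.
rewrite -quot_piZ -quot_piD !quot_piM_subproof -quot_piZ -quot_piD.
by rewrite bmulDl bmulZl.
Qed.

Lemma quot_mul_linearr (x : quot_alg) : linear (quot_mul x).
Proof.
move=> a y z; rewrite -[x]quot_reprK -[y]quot_reprK -[z]quot_reprK.
rewrite -quot_piZ -quot_piD !quot_piM_subproof -quot_piZ -quot_piD.
by rewrite bmulDr bmulZr.
Qed.

HB.instance Definition _ := Lmodule_hasBilinearMul.Build F quot_alg
  quot_mul_linearl quot_mul_linearr.

Lemma quot_piM x y : quot_pi (x \** y) = quot_pi x \** quot_pi y.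
Proof. by rewrite -quot_piM_subproof. Qed.

End QuotientAlgebra.

Section LeibnizKernel.
Variables (F : fieldType) (L : leftLeibnizType F).

Definition Leib : set L := lin_span [set x \** x | x in [set: L]].

Lemma sqr_bmul (x y : L) : (x \** x) \** y = 0.
Proof.
have /eqP := left_leibniz x x y.
by rewrite -subr_eq subrr => /eqP.
Qed.

Lemma Leib_sqr (x : L) : Leib (x \** x).
Proof. by apply: lin_spanS; exists x. Qed.

Lemma Leib_ideal : ideal Leib.
Proof.
split.
- exact: lin_span0.
- exact: lin_spanD.
- exact: lin_spanZ.
- move=> x _ [n [c [s [Ss ->]]]]; rewrite bmul_sumr.
  apply: lin_span_sum => i; rewrite bmulZr; apply: lin_spanZ.
  have [y _ <-] := Ss i; rewrite left_leibniz; set z := x \** y.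
  have -> : z \** y + y \** z =
      (z + y) \** (z + y) + (-1) *: (z \** z) + (-1) *: (y \** y).
    rewrite !scaleN1r bmulDl !bmulDr [z \** z + _]addrC addrACA.
    by rewrite [z \** z + _]addrC addrA !addrK.
  by do !apply: lin_spanD; try apply: lin_spanZ; exact: Leib_sqr.
- move=> _ y [n [c [s [Ss ->]]]]; rewrite bmul_suml big1; first exact: lin_span0.
  by move=> i _; rewrite bmulZl; have [x _ <-] := Ss i; rewrite sqr_bmul scaler0.
Qed.

Definition canonical_lie : Type := quot_alg Leib_ideal.

HB.instance Definition _ := BilinAlg.copy canonical_lie (quot_alg Leib_ideal).

Lemma canonical_lie_alt (x : canonical_lie) : x \** x = 0.
Proof.
have sqr0 (y : quot_alg Leib_ideal) : y \** y = 0; last exact: sqr0.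
rewrite -[y]quot_reprK -quot_piM -(quot_pi0 Leib_ideal).
apply/(quot_piP Leib_ideal); rewrite subr0; exact: Leib_sqr.
Qed.

Lemma canonical_lie_anti (x y : canonical_lie) : x \** y = - (y \** x).
Proof.
apply/eqP; rewrite -addr_eq0; have := canonical_lie_alt (x + y).
by rewrite bmulDl !bmulDr !canonical_lie_alt addr0 add0r => ->.
Qed.

Lemma canonical_lie_leibniz (x y z : canonical_lie) :
  x \** (y \** z) = (x \** y) \** z + y \** (x \** z).
Proof.
have leibQ (u v w : quot_alg Leib_ideal) :
  u \** (v \** w) = (u \** v) \** w + v \** (u \** w); last exact: leibQ.
rewrite -[u]quot_reprK -[v]quot_reprK -[w]quot_reprK -!quot_piM.
by rewrite left_leibniz quot_piD.
Qed.

Lemma canonical_lie_jacobi (x y z : canonical_lie) :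
  x \** (y \** z) + y \** (z \** x) + z \** (x \** y) = 0.
Proof.
rewrite canonical_lie_leibniz [z \** (x \** y)]canonical_lie_anti.
rewrite [z \** x]canonical_lie_anti -[- (x \** z)]sub0r bmulBr bmul0r sub0r.
by rewrite addrK subrr.
Qed.

HB.instance Definition _ := BilinAlg_isLie.Build F canonical_lie
  canonical_lie_alt canonical_lie_jacobi.

Definition lie_simple : Prop := simple_lie canonical_lie.

End LeibnizKernel.

Section HemiSemidirect.
Variables (F : fieldType) (g : lieAlgType F) (M : leftLieModType g).

Definition hemi_semidirect : Type := (g * M)%type.

HB.instance Definition _ := GRing.Lmodule.on hemi_semidirect.

Definition hemi_mul (u v : hemi_semidirect) : hemi_semidirect :=
  (u.1 \** v.1, u.1 \dot v.2).

Lemma hemi_mul_linearl (v : hemi_semidirect) : linear (hemi_mul^~ v).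
Proof.
by move=> a u w; congr pair; [exact: bmul_linearl|exact: lact_linearl].
Qed.

Lemma hemi_mul_linearr (u : hemi_semidirect) : linear (hemi_mul u).
Proof.
by move=> a v w; congr pair; [exact: bmul_linearr|exact: lact_linearr].
Qed.

HB.instance Definition _ := Lmodule_hasBilinearMul.Build F hemi_semidirect
  hemi_mul_linearl hemi_mul_linearr.

Lemma lie_anti (x y : g) : x \** y = - (y \** x).
Proof.
apply/eqP; rewrite -addr_eq0; have := lie_alt (x + y).
by rewrite bmulDl !bmulDr !lie_alt addr0 add0r => ->.
Qed.

Lemma lie_leibniz (x y z : g) :
  x \** (y \** z) = (x \** y) \** z + y \** (x \** z).
Proof.
have /eqP := lie_jacobi x y z; rewrite -addrA addr_eq0 => /eqP ->.
rewrite [z \** (x \** y)]lie_anti [z \** x]lie_anti.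
by rewrite -[- (x \** z)]sub0r bmulBr bmul0r sub0r opprD !opprK addrC.
Qed.

Lemma hemi_left_leibniz (u v w : hemi_semidirect) :
  u \** (v \** w) = (u \** v) \** w + v \** (u \** w).
Proof.
congr pair; first exact: lie_leibniz.
by rewrite /= lact_lie subrK.
Qed.

HB.instance Definition _ := BilinAlg_isLeftLeibniz.Build F hemi_semidirect
  hemi_left_leibniz.

Definition lact_span : set M :=
  lin_span [set m | exists (x : g) (n : M), m = x \dot n].

End HemiSemidirect.

Notation "g \ltimes M" := (@hemi_semidirect _ g M) : type_scope.

Arguments lact_span {F} g M.
Arguments lie_simple {F} L.

(* Main.v *)
Require Import Defs.
From mathcomp Require Import all_boot all_order all_algebra.
From mathcomp Require Import boolp classical_sets.

(** The square of [(x, m)] is [(0, x \dot m)], so the Leibniz kernel of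
    [g \ltimes M] is [0 * gM] and the canonical Lie algebra is [g * (M / gM)].
    Its ideal [0 * (M / gM)] is proper as soon as the algebra is non-abelian,
    so Lie-simplicity forces [gM = M]; and when [gM = M] the canonical Lie
    algebra is [g]. *)

Import GRing.Theory.

Local Open Scope ring_scope.
Local Open Scope classical_set_scope.

Lemma ideal_quot_preimage {F : fieldType} {A : bilinAlgType F} {I : set A}
    (idI : ideal I) (J : set (quot_alg idI)) :
  ideal J -> ideal [set x | J (quot_pi idI x)].
Proof.
case=> J0 JD JZ Jl Jr; split=> [|x y|a x|x y|x y] /=.
- by rewrite quot_pi0.
- by rewrite quot_piD; apply: JD.
- by rewrite quot_piZ; apply: JZ.
- by rewrite quot_piM; apply: Jl.
- by rewrite quot_piM; apply: Jr.
Qed.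

Lemma ideal_quot_image {F : fieldType} {A : bilinAlgType F} {I : set A}
    (idI : ideal I) (J : set A) :
  ideal J -> ideal [set quot_pi idI x | x in J].
Proof.
case=> J0 JD JZ Jl Jr; split.
- by exists 0 => //; rewrite quot_pi0.
- by move=> _ _ [x Jx <-] [y Jy <-]; exists (x + y); rewrite ?quot_piD //; apply: JD.
- by move=> a _ [x Jx <-]; exists (a *: x); rewrite ?quot_piZ //; apply: JZ.
- move=> x _ [y Jy <-]; exists (quot_repr x \** y); first exact: Jl.
  by rewrite quot_piM quot_reprK.
- move=> _ y [x Jx <-]; exists (x \** quot_repr y); first exact: Jr.
  by rewrite quot_piM quot_reprK.
Qed.

Lemma quot_pi_eq0 {F : fieldType} {A : bilinAlgType F} {I : set A}
    (idI : ideal I) (x : A) :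
  quot_pi idI x = 0 <-> I x.
Proof. by rewrite -(quot_pi0 idI) quot_piP subr0. Qed.

(** [J] contains the kernel [I] of the projection, hence is a union of cosets of [I], so membership
    in [J] can be read off from classes. *)
Lemma ideal_quot_imageE {F : fieldType} {A : bilinAlgType F} {I : set A}
    (idI : ideal I) (J : set A) (x : A) :
  ideal J -> I `<=` J -> [set quot_pi idI y | y in J] (quot_pi idI x) <-> J x.
Proof.
move=> idJ IJ; split=> [[y Jy /quot_piP Iyx]|Jx]; last by exists x.
have -> : x = y + (-1) *: (y - x) by rewrite scaleN1r opprB addrC subrK.
by apply: idealD => //; apply: idealZ => //; exact: IJ.
Qed.

(** The correspondence theorem moves Lie-simplicity from the quotient to the ideals of [L] above the
    Leibniz kernel, so that the quotient need not be handled again. *)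
Lemma lie_simpleP {F : fieldType} (L : leftLeibnizType F) :
  lie_simple L <->
  (exists x y : L, ~ @Leib F L (x \** y)) /\
  (forall I : set L, ideal I -> @Leib F L `<=` I ->
     I = @Leib F L \/ I = [set: L]).
Proof.
pose idL := Leib_ideal L.
(* [canonical_lie] is the quotient algebra with a Lie structure added; over the bare quotient the
   lemmas on [quot_pi] apply. *)
have -> : lie_simple L <-> (exists x y : quot_alg idL, x \** y <> 0) /\
  (forall I : set (quot_alg idL), ideal I -> I = [set 0] \/ I = [set: quot_alg idL]).
  split=> -[[x [y xy]] sL]; split; try by exists x, y.
    by move=> I [? ? ? ? ?]; apply: sL; split.
  by move=> I [? ? ? ? ?]; apply: sL; split.
split=> -[[x [y xy]] sL]; split.
- exists (quot_repr x), (quot_repr y); rewrite -(quot_pi_eq0 idL).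
  by rewrite quot_piM !quot_reprK.
- move=> I idI LI.
  have IE z := ideal_quot_imageE idL I z idI LI.
  have [E|E] := sL _ (ideal_quot_image idL I idI); [left|right].
    by apply/seteqP; split=> z; rewrite -IE E /= (quot_pi_eq0 idL).
  by apply/seteqP; split=> z // _; rewrite -IE E.
- by exists (quot_pi idL x), (quot_pi idL y); rewrite -quot_piM (quot_pi_eq0 idL).
- move=> J idJ.
  have LJ : @Leib F L `<=` [set z | J (quot_pi idL z)].
    by move=> z /(quot_pi_eq0 idL) /= ->; exact: ideal0.
  (* An ideal of the quotient is recovered from its preimage, since each class has a
     representative. *)
  have JE z : J z = [set w | J (quot_pi idL w)] (quot_repr z).
    by rewrite /= quot_reprK.
  have [E|E] := sL _ (ideal_quot_preimage idL J idJ) LJ; [left|right].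
    apply/seteqP; split=> z; rewrite JE E -(quot_pi_eq0 idL).
      by rewrite quot_reprK.
    by rewrite quot_reprK.
  by apply/seteqP; split=> z // _; rewrite JE E.
Qed.

Section HemiSemidirectKernel.
Context {F : fieldType} {g : lieAlgType F} {M : leftLieModType g}.

Lemma lact0 (x : g) : x \dot (0 : M) = 0.
Proof.
have /eqP := lact_linearr x 1 (0 : M) 0.
by rewrite scaler0 addr0 scale1r -subr_eq subrr => /eqP.
Qed.

Lemma lact_span_lact (x : g) (m : M) : lact_span g M (x \dot m).
Proof. by apply: lin_spanS; exists x, m. Qed.

Lemma hemi_eta (u : g \ltimes M) : u = (u.1, 0) + (0, u.2) :> g * M.
Proof. by case: u => x m; congr pair; rewrite /= ?addr0 ?add0r. Qed.

Lemma Leib_hemiE (u : g \ltimes M) :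
  @Leib F (g \ltimes M) u <-> u.1 = 0 /\ lact_span g M u.2.
Proof.
split=> [[n [c [s [Ss ->]]]]|[]].
  rewrite (raddf_sum (@fst g M)) (raddf_sum (@snd g M)) /=; split.
    rewrite big1 // => i _; have [y _ <-] := Ss i.
    by rewrite /= lie_alt scaler0.
  apply: lin_span_sum => i; apply: lin_spanZ.
  by have [y _ <-] := Ss i; exact: lact_span_lact.
case: u => x m /= -> [n [c [s [Ss ->]]]].
have -> : (0, \sum_(i < n) c i *: s i) =
    \sum_(i < n) c i *: ((0, s i) : g \ltimes M) :> (g \ltimes M).
  apply: (big_ind2 (fun m (u : g \ltimes M) => (0, m) = u)) => //.
    by move=> m1 _ m2 _ <- <-; congr pair; rewrite /= addr0.
  by move=> i _; congr pair; rewrite /= scaler0.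
apply: lin_span_sum => i; apply: lin_spanZ.
(* [(0, y \dot k)] is the square of [(y, k)], because the bracket of [g] is alternating. *)
have [y [k ->]] := Ss i; apply: lin_spanS; exists (y, k) => //.
by congr pair; rewrite /= lie_alt.
Qed.

(** The first projection is a homomorphism onto [g]; the preimages [J * M] serve as test ideals. *)
Lemma ideal_hemi_fst (J : set g) :
  ideal J -> ideal [set u : g \ltimes M | J u.1].
Proof.
case=> J0 JD JZ Jl Jr; split=> [|u v|a u|u v|u v] /=.
- exact: J0.
- exact: JD.
- exact: JZ.
- exact: Jl.
- exact: Jr.
Qed.

(** Since [x \dot 0 = 0], sending [x] to [(x, 0)] is a homomorphism, so ideals pull back along
    it. *)
Lemma ideal_hemi_inl (I : set (g \ltimes M)) :
  ideal I -> ideal [set x : g | I (x, 0)].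
Proof.
case=> I0 ID IZ Il Ir; split=> [|x y Ix Iy|a x Ix|x y Iy|x y Ix] /=.
- exact: I0.
- by have := ID _ _ Ix Iy; congr (I (_, _)); rewrite /= addr0.
- by have := IZ a _ Ix; congr (I (_, _)); rewrite /= scaler0.
- by have := Il (x, 0) _ Iy; congr (I (_, _)); rewrite /= lact0.
- by have := Ir _ (y, 0) Ix; congr (I (_, _)); rewrite /= lact0.
Qed.

End HemiSemidirectKernel.

Theorem theorem2p2 (F : fieldType) (g : lieAlgType F) (M : leftLieModType g) :
  lie_simple (g \ltimes M) <-> simple_lie g /\ lact_span g M = [set: M].
Proof.
rewrite lie_simpleP.
have Leib_fst0 (u : g \ltimes M) : Leib u -> u.1 = 0.
  by move=> /Leib_hemiE[].
split=> [[[u [v uv]] sL]|[[[x [y xy]] sg] gM]].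
  (* The second component of a product always lies in [gM], so a product outside the kernel has a
     nonzero first component. *)
  have uv1 : u.1 \** v.1 <> 0.
    by move=> E; apply: uv; apply/Leib_hemiE; split=> //; exact: lact_span_lact.
  have sJ (J : set g) : ideal J ->
      [set w : g \ltimes M | J w.1] = @Leib F (g \ltimes M) \/ J = [set: g].
    move=> idJ.
    have LJ : @Leib F (g \ltimes M) `<=` [set w : g \ltimes M | J w.1].
      by move=> w /Leib_fst0 /= ->; exact: ideal0.
    have [->|E] := sL _ (ideal_hemi_fst _ idJ) LJ; first by left.
    right; apply/seteqP; split=> z // _.
    by have : [set: g \ltimes M] (z, 0) by []; rewrite -E.
  split; first split; first by exists u.1, v.1.
    move=> J idJ; have [E|] := sJ J idJ; [left|by right].
    (* Elements of the kernel have zero first component, so [J * M] can equal it only if [J = 0]. *)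
    apply/seteqP; split=> [z Jz|_ ->]; last exact: ideal0.
    by apply: (Leib_fst0 (z, 0)); rewrite -E.
  (* For [J = 0] the test ideal is [0 * M]. If it is the kernel [0 * gM], then [gM = M]; the other
     case, [0 = g], contradicts the nonzero bracket. *)
  have id0 : ideal [set (0 : g)].
    split=> [|_ _ -> ->|a _ ->|z _ ->|_ z ->] //=.
    - by rewrite addr0.
    - by rewrite scaler0.
    - by rewrite bmul0r.
    - by rewrite bmul0l.
  have [E|E] := sJ _ id0.
    apply/seteqP; split=> m // _.
    suff /Leib_hemiE[] : @Leib F (g \ltimes M) (0, m) by [].
    by rewrite -E.
  by case: uv1; have : [set: g] (u.1 \** v.1) by []; rewrite -E.
split; first by exists (x, 0), (y, 0) => /Leib_fst0.
move=> I idI LI.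
(* As [gM = M], the kernel is all of [0 * M], and an ideal containing it is determined by its trace
   on [g]. *)
have LeibE (u : g \ltimes M) : u.1 = 0 -> Leib u.
  by move=> u0; apply/Leib_hemiE; rewrite gM.
have [E|E] := sg _ (ideal_hemi_inl _ idI); [left|right].
  apply/seteqP; split=> // u Iu; apply: (LeibE u).
  suff : [set z : g | I (z, 0)] u.1 by rewrite E.
  (* Subtracting the kernel element [(0, u.2)] from [u] keeps it in [I] and puts [u.1] in the trace,
     which is zero here. *)
  rewrite /=; have -> : (u.1, 0) = u + (-1) *: ((0, u.2) : g \ltimes M) :> (g \ltimes M).
    by case: u {Iu} => z m; congr pair; rewrite /= ?scaler0 ?addr0 // scaleN1r subrr.
  by apply: idealD => //; apply: idealZ => //; apply: LI; exact: LeibE.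
apply/seteqP; split=> u // _; rewrite [u]hemi_eta; apply: (idealD idI).
  by have : [set: g] u.1 by []; rewrite -E.
by apply: LI; exact: LeibE.
Qed.
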